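(* Let $n\geq 3$ and $1\leq k<n/2$ be integers, and let $C$ be a nonempty proper subset of $V(GP(n,k))$. Then $C$ is a completely regular code of covering radius one in $GP(n,k)$ if and only if the partition $\{C,V(GP(n,k))\setminus C\}$ is equitable and has, up to interchanging the two cells, one of the following quotient matrices, where each matrix is listed with the condition on $(n,k)$ under which it is admitted: $A_1=\begin{pmatrix}2&1\\1&2\end{pmatrix}$ (all $n,k$); $A_2=\begin{pmatrix}2&1\\2&1\end{pmatrix}$ ($3\mid n$ and $3\nmid k$); $A_3=\begin{pmatrix}1&2\\2&1\end{pmatrix}$ ($2\mid n$ and $k$ odd); $A_4=\begin{pmatrix}0&3\\1&2\end{pmatrix}$ ($4\mid n$ and $k$ odd); $A_5=\begin{pmatrix}0&3\\2&1\end{pmatrix}$ ($5\mid n$ and $k\equiv\pm2\pmod 5$); $A_6=\begin{pmatrix}0&3\\3&0\end{pmatrix}$ ($2\mid n$ and $k$ odd). Equivalently, the possible intersection arrays $\{b;c\}$ of completely regular codes of covering radius one in $GP(n,k)$ are exactly the following, each occurring if and only if the stated condition holds: $\{1;1\}$: all $n,k$; $\{1;2\}$ and $\{2;1\}$: $3\mid n$ and $3\nmid k$; $\{2;2\}$: $2\mid n$ and $k$ odd; $\{3;1\}$ and $\{1;3\}$: $4\mid n$ and $k$ odd; $\{3;2\}$ and $\{2;3\}$: $5\mid n$ and $k\equiv\pm2\pmod 5$; $\{3;3\}$: $2\mid n$ and $k$ odd.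
   Context: For integers $n\ge 3$ and $1\le k<n/2$, the generalized Petersen graph $GP(n,k)$ is the (cubic, connected) graph with vertex set $\{a_i,b_i: i\in\mathbb Z_n\}$ and edge set $\{a_ia_{i+1},\ a_ib_i,\ b_ib_{i+k}: i\in\mathbb Z_n\}$, with indices read modulo $n$. A partition of the vertex set of a graph into cells $C_1,\dots,C_m$ is equitable with quotient matrix $S=(s_{ij})$ if every vertex of $C_i$ has exactly $s_{ij}$ neighbours in $C_j$, for all $i,j$. Interchanging the two cells of a two-cell partition replaces $\begin{pmatrix} a & b \\ c & d \end{pmatrix}$ by $\begin{pmatrix} d & c \\ b & a \end{pmatrix}$. Let $G$ be a connected graph and $\emptyset\neq C\subseteq V(G)$. The distance partition with respect to $C$ has cells $\{v: d(v,C)=i\}$, $i=0,1,\dots,\rho$, where $\rho=\max_v d(v,C)$ is the covering radius of $C$. The set $C$ is a completely regular code if its distance partition is equitable. If $C$ is a completely regular code of covering radius one, then its distance partition is $\{C,V(G)\setminus C\}$; its intersection array is $\{b;c\}$, where every vertex of $C$ has exactly $b$ neighbours outside $C$ and every vertex outside $C$ has exactly $c$ neighbours in $C$ (so if the quotient matrix with $C$ as first cell is $\begin{pmatrix} a & b \\ c & d \end{pmatrix}$, the intersection array of $C$ is $\{b;c\}$). The array $\{b;c\}$ is ordered. *)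

(* Defs.v *)
From mathcomp Require Import all_boot all_order all_algebra.

Set Implicit Arguments.
Unset Strict Implicit.
Unset Printing Implicit Defensive.

Import GRing.Theory.

(* A finite simple graph is a symmetric irreflexive adjacency relation [e] on
   its vertex type [T]. *)
Section Codes.

Variables (T : finType) (e : rel T).

Definition has_walk (m : nat) (x y : T) : bool :=
  [exists p : m.-tuple T, path e x p && (last x p == y)].

(* Least length of a walk from x to y.  A shortest walk has length < #|T|, and
   the value is #|T| exactly when y is not reachable from x. *)
Definition graph_dist (x y : T) : nat :=
  find (fun m => has_walk m x y) (iota 0 #|T|).

Definition dist_to (v : T) (C : {set T}) : nat :=
  \big[minn/#|T|]_(x in C) graph_dist v x.

Definition covering_radius (C : {set T}) : nat := \max_(v : T) dist_to v C.

Definition distance_partition (C : {set T})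
    (i : 'I_(covering_radius C).+1) : {set T} :=
  [set v | dist_to v C == i].

(* The cells are indexed, and injectivity together with [partition] makes them
   nonempty, pairwise disjoint and covering. *)
Definition equitable (m : nat) (P : 'I_m -> {set T}) (S : 'M[nat]_m) : Prop :=
  [/\ injective P,
      partition [set P i | i : 'I_m] [set: T]
    & forall (i j : 'I_m) (v : T),
        v \in P i -> #|[set w in P j | e v w]| = S i j].

Definition completely_regular (C : {set T}) : Prop :=
  C != set0 /\
  exists S : 'M[nat]_((covering_radius C).+1), equitable (@distance_partition C) S.

Definition two_cells (C D : {set T}) (i : 'I_2) : {set T} :=
  if i == ord0 then C else D.

(* Only the counting condition of the array {b; c}: that C is a completely
   regular code of covering radius one is to be required separately. *)
Definition has_intersection_array (C : {set T}) (b c : nat) : Prop :=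
  (forall v, v \in C -> #|[set w in ~: C | e v w]| = b) /\
  (forall v, v \notin C -> #|[set w in C | e v w]| = c).

End Codes.

Definition mx2 (a b c d : nat) : 'M[nat]_2 :=
  \matrix_(i, j) if i == ord0 then if j == ord0 then a else b
                 else if j == ord0 then c else d.

(* [inl i] is the vertex a_i and [inr i] the vertex b_i.  The type 'Z_n is the
   ring of integers modulo n only for n >= 2. *)
Definition gp_vertex (n : nat) : finType := ('Z_n + 'Z_n)%type.

Definition gp_adj (n k : nat) : rel (gp_vertex n) := fun u v =>
  match u, v with
  | inl i, inl j => (j == i + 1)%R || (i == j + 1)%R
  | inl i, inr j | inr i, inl j => i == j
  | inr i, inr j => (j == i + k%:R)%R || (i == j + k%:R)%R
  end.

(* Main.v *)
Require Import Defs.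
From mathcomp Require Import all_boot all_order all_algebra all_field.
From mathcomp Require Import ring zify.

Set Implicit Arguments.
Unset Strict Implicit.
Unset Printing Implicit Defensive.

Import GRing.Theory Num.Theory.

(** Let C be a set of vertices, and put x_i = 1 when a_i is in C, y_i = 1 when
    b_i is in C, and 0 otherwise.  In a cubic graph, a nonempty proper C is a
    completely regular code of covering radius one exactly when every vertex of
    C has the same number b > 0 of neighbours outside C and every other vertex
    the same number c > 0 of neighbours in C ([completely_regular_radius1]).  As
    b and c are at most 3, there are nine arrays to examine.

    Existence ([admissible_array]).  Each array, or the array of the complement,
    is realized by a colouring that depends only on whether the vertex is an a_i
    or a b_i and on the residue of i modulo some m <= 5 dividing n; the check is
    a finite computation with the residue of k.

    Necessity ([array_admissible]).  With lam = 3 - b - c, counting neighbours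
    gives the linear equations
      x_(i+1) + x_(i-1) + y_i = c + lam x_i,
      y_(i+k) + y_(i-k) + x_i = c + lam y_i.
    Summing them over i shows that x has total A with (b + c) A = c n, whence
    the divisibility conditions on n.  Transforming them by an n-th root of
    unity z <> 1, with p = z + 1/z and q = z^k + 1/z^k, gives
      ((p - lam) (q - lam) - 1) X(z) = 0.
    Take a prime l dividing b + c, namely l = 3, 2, 5, 2 for b + c = 3, 4, 5, 6
    (b = c = 1 carries no condition), and suppose that k violates the stated
    condition.  Then the first factor is nonzero at every z <> 1 of l-power order: modulo
    powers of s = z - 1, which lies over l, one has p = 2 + s^2, q = 2 + k^2 s^2
    up to s^3, and with c0 = 2 - lam = b + c - 1 the factor is
      c0^2 - 1 + c0 (1 + k^2) s^2 + O(s^3),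
    where s^3 divides c0^2 - 1 = (b + c) (b + c - 2) and l does not divide
    c0 (1 + k^2) ([gp_char_det_neq0]).  The only exception to that divisibility
    is z of order 3, treated directly.  So X vanishes at all nontrivial roots of
    unity of order dividing N, the l-part of n.  By Fourier inversion A is N
    times an integer a ([dvdn_sum_of_vanishing]), and then (b + c) a = c n / N
    with n / N prime to l, which is impossible as l divides b + c to a higher
    power than c. *)

(** * Codes of covering radius one *)

Section Graph.
Variables (T : finType) (e : rel T).
Implicit Types C : {set T}.

Lemma has_walk0 v w : has_walk e 0 v w = (v == w).
Proof.
apply/existsP/idP => [[p]|vw]; first by rewrite (tuple0 p).
by exists [tuple].
Qed.

Lemma has_walk1 v w : has_walk e 1 v w = e v w.
Proof.
apply/existsP/idP => [[p]|vw]; last by exists [tuple w]; rewrite /= vw eqxx.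
by case/tupleP: p => u p; rewrite (tuple0 p) /= andbT => /andP[vu /eqP <-].
Qed.

Lemma graph_dist_le0 v w : (graph_dist e v w <= 0) = (v == w).
Proof.
have T0 : 0 < #|T| by apply/card_gt0P; exists v.
by rewrite /graph_dist -(prednK T0) /= has_walk0; case: eqP.
Qed.

(** Since [graph_dist] returns [#|T|] for unreachable pairs, a distance test at
    radius m is only meaningful below [#|T|]; hence the cardinality hypothesis
    here and in the lemmas that follow. *)
Lemma graph_dist_le1 v w : 1 < #|T| -> (graph_dist e v w <= 1) = (v == w) || e v w.
Proof.
case Em: #|T| => [|[|m]] // _.
by rewrite /graph_dist Em /= has_walk0 has_walk1; case: eqP => //= _; case: e.
Qed.

Lemma dist_to_le v C m : m < #|T| ->
  (dist_to e v C <= m) = [exists w in C, graph_dist e v w <= m].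
Proof.
move=> mT; rewrite /dist_to -big_orE.
apply: (big_morph (fun d => d <= m)) => [d1 d2|]; first by rewrite geq_min.
by rewrite leqNgt mT.
Qed.

Lemma dist_to_le0 v C : (dist_to e v C <= 0) = (v \in C).
Proof.
rewrite dist_to_le; last by apply/card_gt0P; exists v.
apply/existsP/idP => [[w] | vC]; last by exists v; rewrite vC graph_dist_le0 eqxx.
by rewrite graph_dist_le0 => /andP[wC /eqP ->].
Qed.

Lemma dist_to_le1 v C : 1 < #|T| ->
  (dist_to e v C <= 1) = (v \in C) || (0 < #|[set w in C | e v w]|).
Proof.
move=> T1; rewrite dist_to_le //; apply/existsP/orP => [[w]|].
  rewrite graph_dist_le1 // => /andP[wC /orP[/eqP-> | vw]]; first by left.
  by right; apply/card_gt0P; exists w; rewrite inE wC.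
case=> [vC | /card_gt0P[w]]; first by exists v; rewrite vC graph_dist_le1 ?eqxx.
by rewrite inE => /andP[wC vw]; exists w; rewrite wC graph_dist_le1 ?vw ?orbT.
Qed.

Lemma dist_le_radius v C : dist_to e v C <= covering_radius e C.
Proof. exact: leq_bigmax. Qed.

Lemma intersection_array_compl C b c :
  has_intersection_array e C b c -> has_intersection_array e (~: C) c b.
Proof.
by case=> Cb Cc; split=> v; rewrite inE ?negbK ?setCK; [apply: Cc | apply: Cb].
Qed.

Lemma intersection_array_inj C b c b' c' : C != set0 -> C \proper [set: T] ->
  has_intersection_array e C b c -> has_intersection_array e C b' c' ->
  b = b' /\ c = c'.
Proof.
case/set0Pn=> v vC /properP[_ [w _ wC]] [Cb Cc] [Cb' Cc'].
by rewrite -(Cb v vC) -(Cb' v vC) -(Cc w wC) -(Cc' w wC).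
Qed.

(** A vertex on either side of C has a neighbour on the other side, so positive
    entries alone force both cells to be nonempty. *)
Lemma intersection_array_proper C b c (v : T) :
  has_intersection_array e C b c -> 0 < b -> 0 < c ->
  C != set0 /\ C \proper [set: T].
Proof.
move=> [Cb Cc] b0 c0.
case: (boolP (v \in C)) => vC.
  have /card_gt0P[w] : 0 < #|[set w in ~: C | e v w]| by rewrite Cb.
  rewrite !inE => /andP[wC _]; split; first by apply/set0Pn; exists v.
  by apply/properP; split; [apply: subsetT | exists w].
have /card_gt0P[w] : 0 < #|[set w in C | e v w]| by rewrite Cc.
rewrite !inE => /andP[wC _]; split; first by apply/set0Pn; exists w.
by apply/properP; split; [apply: subsetT | exists v].
Qed.

Lemma two_cells_array C (S : 'M[nat]_2) : 
  equitable e (two_cells C (~: C)) S ->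
  has_intersection_array e C (S ord0 ord_max) (S ord_max ord0).
Proof.
case=> _ _ ES; split=> v vC; first by rewrite -(ES ord0 ord_max v).
by rewrite -(ES ord_max ord0 v) //; rewrite /two_cells /= inE.
Qed.

Section Regular.
Variable r : nat.
Hypothesis e_regular : forall v, #|[set w | e v w]| = r.

Lemma card_nbrs_split C v :
  #|[set w in C | e v w]| + #|[set w in ~: C | e v w]| = r.
Proof.
rewrite -(e_regular v) -(cardsID C [set w | e v w]); congr (_ + _).
  by apply: eq_card => w; rewrite !inE andbC.
by apply: eq_card => w; rewrite !inE.
Qed.

(** The cells are indexed by an ordinal of size m = 2 rather than by ['I_2], so
    that the lemma also covers the distance partition, whose index type is
    ['I_(covering_radius e C).+1]. *)
Lemma array_equitable m (P : 'I_m -> {set T}) C (S : 'M[nat]_m) b c :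
    m = 2 -> C != set0 -> C \proper [set: T] ->
    (forall i, P i = if i == 0 :> nat then C else ~: C) ->
    has_intersection_array e C b c ->
    (forall i j, S i j = if i == 0 :> nat then if j == 0 :> nat then r - b else b
                         else if j == 0 :> nat then c else r - c) ->
  equitable e P S.
Proof.
move=> m2 /set0Pn[v0 v0C] /properP[_ [v1 _ v1C]] EP [Cb Cc] ES; subst m.
have mem_P i v : (v \in P i) = ((v \in C) == (i == 0 :> nat)).
  by rewrite EP; case: (_ == _); rewrite ?inE ?eqb_id ?eqbF_neg.
have mem_P_i i v : v \in P i -> (i == 0 :> nat) = (v \in C).
  by rewrite mem_P => /eqP ->.
have P_eq i j v : v \in P i -> v \in P j -> i = j.
  move=> /mem_P_i vi /mem_P_i; rewrite -vi => ij; apply: val_inj => /=.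
  by case: i j ij {vi} => [[|[|//]] ?] [[|[|//]] ?].
have P_pick i : exists v, v \in P i.
  case: (eqVneq (i : nat) 0) => i0; [exists v0 | exists v1]; rewrite mem_P.
    by rewrite i0 v0C.
  by rewrite (negPf i0) (negPf v1C).
split.
- move=> i j Pij; have [v vi] := P_pick i.
  by apply: (P_eq i j v) => //; rewrite -Pij.
- apply/and3P; split.
  + apply/eqP/setP => v; rewrite inE; apply/bigcupP.
    exists (P (if v \in C then ord0 else ord_max)); first exact: imset_f.
    by rewrite mem_P; case: (v \in C).
  + apply/trivIsetP => _ _ /imsetP[i _ ->] /imsetP[j _ ->] nPij.
    rewrite -setI_eq0; apply: contraNT nPij => /set0Pn[v /setIP[vi vj]].
    by rewrite (P_eq i j v).
  + by apply/imsetP => -[i _ P0]; have [v] := P_pick i; rewrite -P0 inE.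
move=> i j v /mem_P_i; rewrite ES EP => ->; have := card_nbrs_split C v.
case: (boolP (v \in C)) => vC; [rewrite (Cb v vC) | rewrite (Cc v vC)] => <-;
  case: (j == 0 :> nat); rewrite ?addnK ?addKn //.
  exact: Cb.
exact: Cc.
Qed.

Lemma array_two_cells_equitable C b c :
  C != set0 -> C \proper [set: T] -> has_intersection_array e C b c ->
  equitable e (two_cells C (~: C)) (mx2 (r - b) b c (r - c)).
Proof.
move=> C0 CT Cbc; apply: (array_equitable _ C0 CT _ Cbc) => // i j.
by rewrite mxE.
Qed.

Hypothesis e_sym : symmetric e.

(** Radius one says that every vertex outside C has a neighbour in C, which is
    c > 0; by symmetry of the adjacency one such edge also gives b > 0.  The
    diagonal entries of the quotient matrix are recovered from regularity. *)
Lemma completely_regular_radius1 C : C != set0 -> C \proper [set: T] ->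
  (completely_regular e C /\ covering_radius e C = 1) <->
  exists b c, [/\ 0 < b, 0 < c & has_intersection_array e C b c].
Proof.
move=> C0 CT; have /set0Pn[v0 v0C] := C0; have /properP[_ [v1 _ v1C]] := CT.
have T1 : 1 < #|T|.
  apply/card_gt1P; exists v0, v1; split=> //.
  by apply: contraNneq v1C => <-.
have le1P v : dist_to e v C <= 1 -> v \notin C -> 0 < #|[set w in C | e v w]|.
  by rewrite dist_to_le1 // => /orP[->|].
split=> [[[_ [S [_ _ ES]]] cr1] | [b [c [b0 c0 Cbc]]]].
  have cell (i : 'I_(covering_radius e C).+1) :
      @distance_partition T e C i = if i == 0 :> nat then C else ~: C.
    apply/setP => v; rewrite inE.
    have dv : dist_to e v C <= 1 by rewrite -cr1 dist_le_radius.
    have := dist_to_le0 v C; case: i => [[|[|i]] /= lt_i]; last by rewrite cr1 in lt_i.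
      by rewrite leqn0.
    by rewrite inE => <-; case: (dist_to e v C) dv => [|[]].
  have lt1 : 1 < (covering_radius e C).+1 by rewrite cr1.
  have arr : has_intersection_array e C (S ord0 (Ordinal lt1)) (S (Ordinal lt1) ord0).
    split=> v vC; rewrite -(ES _ _ v) !cell //.
    by rewrite inE.
  have c0 : 0 < S (Ordinal lt1) ord0.
    have [_ Cc] := arr; rewrite -(Cc v1 v1C).
    by apply: le1P => //; rewrite -cr1 dist_le_radius.
  exists (S ord0 (Ordinal lt1)), (S (Ordinal lt1) ord0); split => //.
  have [Cb Cc] := arr; rewrite -(Cc v1 v1C) in c0.
  have /card_gt0P[w] := c0; rewrite inE => /andP[wC v1w].
  by rewrite -(Cb w wC); apply/card_gt0P; exists v1; rewrite !inE v1C e_sym.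
have [Cb Cc] := Cbc.
have dist1 v : dist_to e v C = (v \notin C) :> nat.
  have := dist_to_le0 v C; have := dist_to_le1 v C T1.
  case: (boolP (v \in C)) => vC /=; first by case: (dist_to e v C).
  by rewrite Cc // c0; case: (dist_to e v C) => [|[]].
have cr1 : covering_radius e C = 1.
  apply/eqP; rewrite eqn_leq; apply/andP; split.
    by apply/bigmax_leqP => v _; rewrite dist1 leq_b1.
  by have := dist_le_radius v1 C; rewrite dist1 v1C.
split=> //; split=> //.
exists (\matrix_(i, j) (if i == 0 :> nat then if j == 0 :> nat then r - b else b
                        else if j == 0 :> nat then c else r - c)%N)%R.
apply: (array_equitable _ C0 CT _ Cbc) => [|i|i j]; rewrite ?mxE ?cr1 //.
apply/setP => v; rewrite inE dist1.
by case: i => [[|[|i]] lt_i] /=; rewrite ?inE; [case: (v \in C) .. | rewrite cr1 in lt_i].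
Qed.

End Regular.
End Graph.

(** * Neighbourhoods in the generalized Petersen graph *)

Local Open Scope ring_scope.

Lemma Zp_natE n (k : nat) : (2 < n)%N -> (k < n)%N -> (k%:R : 'Z_n) = k :> nat.
Proof. by move=> n3 kn; rewrite val_Zp_nat ?modn_small // ltnW. Qed.

(** This is where k < n/2 enters: it keeps the two neighbours of b_i on the inner
    rim distinct. *)
Lemma Zp_double_neq0 n k : (2 < n)%N -> (0 < k)%N -> (2 * k < n)%N ->
  (k%:R + k%:R != 0 :> 'Z_n).
Proof.
move=> n3 k0 kn; rewrite -natrD addnn -mul2n.
by apply/eqP => /(congr1 val) /=; rewrite Zp_natE //; lia.
Qed.

Lemma Zp_addE n (i j : 'Z_n) : (1 < n)%N ->
  (i + j : 'Z_n) = ((i + j)%N %% n)%N :> nat.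
Proof. by move=> n1; rewrite /GRing.add /= {3}Zp_cast. Qed.

Local Close Scope ring_scope.

Lemma card_set_in_seq (T : finType) (D : {set T}) (s : seq T) :
  uniq s -> #|[set w in D | w \in s]| = count (mem D) s.
Proof.
move=> us; rewrite -size_filter -(card_uniqP (filter_uniq _ us)).
by apply: eq_card => w; rewrite !inE mem_filter.
Qed.

Section Neighbours.
Local Open Scope ring_scope.
Variables (n k : nat) (n3 : (2 < n)%N) (k0 : (0 < k)%N) (kn : (2 * k < n)%N).
Local Notation adj := (@gp_adj n k).

Lemma gp_inlE i j : (inl i == inl j :> gp_vertex n) = (i == j).
Proof. by []. Qed.

Lemma gp_inrE i j : (inr i == inr j :> gp_vertex n) = (i == j).
Proof. by []. Qed.

Lemma gp_inlrE i j : ((inl i == inr j :> gp_vertex n) = false) *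
                     ((inr i == inl j :> gp_vertex n) = false).
Proof. by []. Qed.

Definition gp_nbrs (v : gp_vertex n) : seq (gp_vertex n) :=
  match v with
  | inl i => [:: inl (i + 1); inl (i - 1); inr i]
  | inr i => [:: inr (i + k%:R); inr (i - k%:R); inl i]
  end.

Lemma gp_nbrs_uniq v : uniq (gp_nbrs v).
Proof.
have neq (i : 'Z_n) m : (0 < m)%N -> (2 * m < n)%N -> i + m%:R != i - m%:R.
  move=> m0 mn; rewrite (inj_eq (addrI i)) -subr_eq0 opprK.
  exact: Zp_double_neq0.
case: v => i; rewrite /= !inE ?gp_inlE ?gp_inrE ?gp_inlrE !orbF andbT.
  by rewrite (neq i 1%N) //; lia.
by rewrite neq.
Qed.

Lemma gp_adjE v w : adj v w = (w \in gp_nbrs v).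
Proof.
have sub (i j c : 'Z_n) : (i == j + c) = (j == i - c) by rewrite [RHS]eq_sym subr_eq.
case: v w => i [] j; rewrite !inE ?gp_inlE ?gp_inrE ?gp_inlrE ?orbF /=.
- by rewrite (sub i j).
- exact: eq_sym.
- exact: eq_sym.
- by rewrite (sub i j).
Qed.

Lemma gp_count (D : {set gp_vertex n}) v :
  #|[set w in D | adj v w]| = count (mem D) (gp_nbrs v).
Proof.
rewrite -card_set_in_seq ?gp_nbrs_uniq //.
by apply: eq_card => w; rewrite !inE gp_adjE.
Qed.

Lemma gp_cubic v : #|[set w | adj v w]| = 3%N.
Proof.
rewrite (_ : #|_| = #|[set w in setT | adj v w]|); last first.
  by apply: eq_card => w; rewrite !inE.
by rewrite gp_count; case: v => i /=; rewrite !inE.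
Qed.

Lemma gp_adj_sym : symmetric adj.
Proof. by case=> i [] j /=; rewrite // orbC. Qed.

End Neighbours.

(** * Codes read off a residue *)

Definition admissible n k b c : Prop :=
  (b, c) = (1, 1) \/
  (((b, c) = (1, 2) \/ (b, c) = (2, 1)) /\ 3 %| n /\ ~~ (3 %| k)) \/
  ((b, c) = (2, 2) /\ 2 %| n /\ odd k) \/
  (((b, c) = (3, 1) \/ (b, c) = (1, 3)) /\ 4 %| n /\ odd k) \/
  (((b, c) = (3, 2) \/ (b, c) = (2, 3)) /\ 5 %| n /\
     (k = 2 %[mod 5] \/ k + 2 = 0 %[mod 5])) \/
  ((b, c) = (3, 3) /\ 2 %| n /\ odd k).

Lemma admissible_gt0 n k b c : admissible n k b c -> 0 < b /\ 0 < c.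
Proof.
by case=> [[-> ->] | [[[[-> ->]|[-> ->]] _] | [[[-> ->] _] |
  [[[[-> ->]|[-> ->]] _] | [[[[-> ->]|[-> ->]] _] | [[-> ->] _]]]]]].
Qed.

Section Residues.
Variables (n k : nat) (n3 : 2 < n) (k0 : 0 < k) (kn : 2 * k < n).
Local Notation adj := (@gp_adj n k).

Definition residue_code m (f g : pred nat) : {set gp_vertex n} :=
  [set v : gp_vertex n | match v with inl i => f (i %% m) | inr i => g (i %% m) end].

(** The neighbour count for one of the two rims, on which neighbours differ by s;
    f colours that rim and g the other one.  The residue a is that of the
    neighbour i - s, so that only additions occur and the condition can be
    computed. *)
Definition cycle_balanced m s b c (f g : pred nat) :=
  all (fun a => f ((a + s + s) %% m) + f a + g ((a + s) %% m)
                == if f ((a + s) %% m) then 3 - b else c) (iota 0 m).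

Lemma cycle_balancedP m s b c (f g : pred nat) (i : 'Z_n) : m %| n ->
  cycle_balanced m (s %% m) b c f g ->
  f ((i + s%:R : 'Z_n)%R %% m) + f ((i - s%:R : 'Z_n)%R %% m) + g (i %% m)
  = if f (i %% m) then 3 - b else c.
Proof.
move=> mn /allP bal; set j := (i - s%:R)%R.
have val_add (h : 'Z_n) : (h + s%:R : 'Z_n)%R %% m = (h %% m + s %% m) %% m.
  rewrite Zp_addE ?(ltnW n3) // val_Zp_nat ?(ltnW n3) // modnDmr modn_dvdm //.
  by rewrite modnDm.
have -> : i = (j + s%:R)%R by rewrite subrK.
rewrite !val_add; have := bal (j %% m); rewrite mem_iota /= add0n ltn_pmod.
  by move/(_ isT)/eqP; rewrite (modnDml (_ + _)).
by apply: dvdn_gt0 mn; apply: leq_trans n3.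
Qed.

Lemma residue_code_array m b c (f g : pred nat) : m %| n -> b <= 3 ->
  cycle_balanced m (1 %% m) b c f g -> cycle_balanced m (k %% m) b c g f ->
  has_intersection_array adj (residue_code m f g) b c.
Proof.
move=> mn b3 bal_f bal_g.
have cnt v : #|[set w in residue_code m f g | adj v w]|
             = if v \in residue_code m f g then 3 - b else c.
  rewrite gp_count //; case: v => i; rewrite /= !inE addn0 addnA.
    exact: cycle_balancedP bal_f.
  exact: cycle_balancedP bal_g.
split=> v vC; have := cnt v; first rewrite vC; last by rewrite (negPf vC).
by have := card_nbrs_split (gp_cubic n3 k0 kn) (residue_code m f g) v; lia.
Qed.

(** Arrays with b < c come from those with b > c by complementing.  The code for
    {3;1} is perfect, with a_i for i = 0 and b_i for i = 2 modulo 4; the code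
    for {2;1}, all a_i and b_i with i = 0 modulo 3, is total perfect. *)
Lemma admissible_array b c : admissible n k b c ->
  exists C : {set gp_vertex n}, has_intersection_array adj C b c.
Proof.
have swap b' c' : (exists C : {set gp_vertex n}, has_intersection_array adj C b' c') ->
    exists C : {set gp_vertex n}, has_intersection_array adj C c' b'.
  by case=> C arr; exists (~: C); apply: intersection_array_compl.
have mod_lt m : 0 < m -> k %% m < m by apply: ltn_pmod.
case=> [[-> ->] | [[bc [n_3 k_3]] | [[[-> ->] [n_2 k_odd]] |
  [[bc [n_4 k_odd]] | [[bc [n_5 k_5]] | [[-> ->] [n_2 k_odd]]]]]]].
- exists (residue_code 1 xpredT xpred0); apply: residue_code_array => //.
- have arr : exists C : {set gp_vertex n}, has_intersection_array adj C 2 1.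
    exists (residue_code 3 (pred1 0) (pred1 0)); apply: residue_code_array => //.
    by move: (mod_lt 3 isT) k_3; rewrite /dvdn; case: (k %% 3) => [|[|[|]]].
  by case: bc => [[-> ->]|[-> ->]] //; apply: swap.
- exists (residue_code 2 (pred1 0) (pred1 0)); apply: residue_code_array => //.
  by rewrite modn2 k_odd.
- have arr : exists C : {set gp_vertex n}, has_intersection_array adj C 3 1.
    exists (residue_code 4 (pred1 0) (pred1 2)); apply: residue_code_array => //.
    have : odd (k %% 4) by rewrite odd_mod.
    by case: (k %% 4) (mod_lt 4 isT) => [|[|[|[|]]]].
  by case: bc => [[-> ->]|[-> ->]] //; apply: swap.
- have arr : exists C : {set gp_vertex n}, has_intersection_array adj C 3 2.
    exists (residue_code 5 (pred2 1 4) (pred2 2 3)); apply: residue_code_array => //.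
    move: k_5; rewrite -(modnDml k).
    by case: (k %% 5) (mod_lt 5 isT) => [|[|[|[|[|]]]]] // _ [].
  by case: bc => [[-> ->]|[-> ->]] //; apply: swap.
- exists (residue_code 2 (pred1 0) (pred1 1)); apply: residue_code_array => //.
  by rewrite modn2 k_odd.
Qed.

End Residues.

(** * Roots of unity of prime power order *)

Local Open Scope ring_scope.

Lemma eqAmodX e x y m : x \in Aint -> y \in Aint ->
  (x == y %[mod e] -> x ^+ m == y ^+ m %[mod e])%A.
Proof.
move=> Zx Zy xy; elim: m => [|m IHm]; first by rewrite !expr0.
by rewrite !exprS; apply: eqAmodM; rewrite ?rpredX.
Qed.

Lemma eqAmod_sum e (I : Type) (r : seq I) (F G : I -> algC) :
  (forall i, F i == G i %[mod e])%A ->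
  (\sum_(i <- r) F i == \sum_(i <- r) G i %[mod e])%A.
Proof.
move=> FG; elim: r => [|i r IHr]; first by rewrite !big_nil.
by rewrite !big_cons; apply: eqAmodD.
Qed.

(** The Frobenius congruence: the inner binomial coefficients of a p-th power are
    divisible by p. *)
Lemma eqAmod_exprD1 (p : nat) (x : algC) e : prime p -> x \in Aint ->
  ((x + 1) ^+ (p ^ e) == x ^+ (p ^ e) + 1 %[mod p])%A.
Proof.
move=> p_pr Zx; elim: e => [|e IHe]; first by rewrite !expr1.
have Zxe : x ^+ (p ^ e) \in Aint by rewrite rpredX.
rewrite expnSr !exprM.
apply: eqAmod_trans (eqAmodX p _ _ IHe) _.
- by rewrite rpredX // rpredD ?Aint1.
- by rewrite rpredD ?Aint1.
move: (x ^+ _) Zxe => y Zy.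
clear IHe; case: p p_pr => // q q_pr.
rewrite exprD1n big_ord_recr big_ord_recl /= bin0 binn expr0 !mulr1n addrAC.
rewrite (addrC 1) -[X in eqAmod _ _ X]addr0 eqAmodDl.
apply: (@eqAmod_trans _ (\sum_(i < q) 0)); last by rewrite big1.
apply: eqAmod_sum => i; rewrite /bump add1n.
have /dvdnP[c ->] : (q.+1 %| 'C(q.+1, i.+1))%N.
  by rewrite prime_dvd_bin //= ltnS ltn_ord.
by rewrite -mulr_natr natrM mulrA eqAmodMl0 ?rpredM ?rpredX ?rpred_nat.
Qed.

Lemma dvdAP (e a : algC) : e != 0 ->
  reflect (exists2 w, w \in Aint & a = e * w) (e %| a)%A.
Proof.
move=> nz_e; rewrite unfold_in (negPf nz_e); apply: (iffP idP) => [Zw | [w Zw ->]].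
  by exists (a / e); rewrite // mulrC divfK.
by rewrite mulrC mulKf // mulrC.
Qed.

Section PrimePowerRoot.

Variables (p e : nat) (z : algC).
Hypotheses (p_pr : prime p) (z_prim : (p ^ e.+1).-primitive_root z).

Let Zz : z \in Aint := Aint_prim_root z_prim.
Let Zs : z - 1 \in Aint. Proof. by rewrite rpredB ?Aint1. Qed.

Lemma prim_root_subr1_neq0 : z - 1 != 0.
Proof.
rewrite subr_eq0 -[z]expr1 -(prim_order_dvd z_prim) dvdn1.
by rewrite gtn_eqF // -(exp1n e.+1) ltn_exp2r ?prime_gt1.
Qed.

(** The element s = z - 1 lies over p: since (s + 1)^N = z^N = 1 for N the order
    of z, the Frobenius congruence makes s^N divisible by p, so an integer
    divisible by s has an N-th power divisible by p. *)
Lemma dvd_of_subr1_dvd (m : nat) : (z - 1 %| m%:R)%A -> (p %| m)%N.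
Proof.
case/(dvdAP _ prim_root_subr1_neq0) => w Zw Em.
have: ((z - 1) ^+ (p ^ e.+1) == 0 %[mod p])%A.
  rewrite eqAmod_sym -(eqAmodDr _ 1) add0r.
  have := eqAmod_exprD1 e.+1 p_pr Zs.
  by rewrite subrK (prim_expr_order z_prim).
move/(eqAmodMr (rpredX (p ^ e.+1) Zw)); rewrite -exprMn -Em mul0r.
rewrite -natrX eqAmod0_nat Euclid_dvdX //.
by case/andP.
Qed.

Lemma eqAmod_root_1 : (z == 1 %[mod z - 1])%A.
Proof. by rewrite /eqAmod -eqAmod0. Qed.

Lemma eqAmod_rootX_1 m : (z ^+ m == 1 %[mod z - 1])%A.
Proof. by rewrite -[X in eqAmod _ _ X](expr1n _ m); exact: eqAmodX Aint1 eqAmod_root_1. Qed.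

(** The quotient (z^m - 1)/(z - 1) is congruent to m, which is why z^k - 1 looks
    like k (z - 1) to first order. *)
Lemma eqAmod_geom m : (\sum_(i < m) z ^+ i == m%:R %[mod z - 1])%A.
Proof.
rewrite -[m in X in eqAmod _ _ X]card_ord -sumr_const.
by apply: eqAmod_sum => i; apply: eqAmod_rootX_1.
Qed.

Lemma geom_Aint m : \sum_(i < m) z ^+ i \in Aint.
Proof. by rewrite rpred_sum // => i _; rewrite rpredX. Qed.

Lemma geom_order_p : \sum_(i < p) (z ^+ (p ^ e)) ^+ i = 0.
Proof.
have nz : z ^+ (p ^ e) - 1 != 0.
  rewrite subr_eq0 -(prim_order_dvd z_prim) dvdn_Pexp2l ?prime_gt1 //.
  by rewrite ltnn.
apply: (mulfI nz); rewrite mulr0 -subrX1 -exprM -expnSr.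
by rewrite (prim_expr_order z_prim) subrr.
Qed.

(** The p-th root of unity w = z^(p^e) satisfies 1 + w + ... + w^(p-1) = 0, and
    each term is congruent to 1. *)
Lemma subr1_dvd_p : (z - 1 %| p%:R)%A.
Proof.
rewrite -eqAmod0 eqAmod_sym -geom_order_p.
rewrite -[p in X in eqAmod _ _ X]card_ord -sumr_const.
by apply: eqAmod_sum => i; rewrite -exprM eqAmod_rootX_1.
Qed.

(** With c0 = 2 - lam, this is z^(k+1) ((p - lam) (q - lam) - 1), where
    p = z + 1/z and q = z^k + 1/z^k: up to a unit, the characteristic
    determinant at lam of the 2 x 2 block of the adjacency matrix of GP(n,k) on
    the Fourier mode z, as z^2 + 1 - lam z = (z - 1)^2 + c0 z. *)
Definition gp_char_det (c0 : algC) k :=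
  ((z - 1) ^+ 2 + c0 * z) * ((z ^+ k - 1) ^+ 2 + c0 * z ^+ k) - z * z ^+ k.

(** Divided by (z - 1)^2, the determinant is congruent to c0 (1 + k^2) modulo
    z - 1, which is not 0 as z - 1 lies over p. *)
Lemma gp_char_det_neq0 (c0 k : nat) :
  ((z - 1) ^+ 3 %| c0%:R ^+ 2 - 1)%A -> ~~ (p %| c0 * (1 + k ^ 2))%N ->
  gp_char_det c0%:R k != 0.
Proof.
have nz := prim_root_subr1_neq0.
case/(dvdAP _ (expf_neq0 3 nz)) => w Zw Ew; apply: contra => /eqP P0.
apply: dvd_of_subr1_dvd; rewrite -eqAmod0.
pose g := \sum_(i < k) z ^+ i.
have Eg : z ^+ k - 1 = (z - 1) * g by rewrite subrX1.
(* Q is the determinant divided by (z - 1)^2 *)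
pose Q := (z - 1) * ((z - 1) * g ^+ 2 + w * (z * z ^+ k)) + c0%:R * (z ^+ k + z * g ^+ 2).
have Q0 : Q = 0.
  apply: (mulfI (expf_neq0 2 nz)); rewrite mulr0 -P0 /gp_char_det Eg /Q.
  move: Ew; move: (z) (z ^+ k) (g) (c0%:R) => u q h c Ew.
  have -> : (u - 1) ^+ 2 * ((u - 1) * ((u - 1) * h ^+ 2 + w * (u * q)) + c * (q + u * h ^+ 2))
    = (u - 1) ^+ 4 * h ^+ 2 + (u - 1) ^+ 3 * w * (u * q) +
      (u - 1) ^+ 2 * c * (q + u * h ^+ 2) by ring.
  rewrite -Ew; ring.
have Zg : g \in Aint := geom_Aint k.
have Zk : z ^+ k \in Aint by rewrite rpredX.
have Zc : c0%:R \in Aint by rewrite rpred_nat.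
rewrite -[X in eqAmod _ _ X]Q0 eqAmod_sym /Q natrM.
rewrite -[X in eqAmod _ _ X]add0r; apply: eqAmodD.
  by rewrite eqAmodMr0 // rpredD ?rpredM ?rpredX.
apply: eqAmodMl => //; rewrite natrD natrX; apply: eqAmodD.
  exact: eqAmod_rootX_1.
rewrite -[X in eqAmod _ _ X]mul1r; apply: eqAmodM; rewrite ?rpredX ?rpred_nat //.
  exact: eqAmod_root_1.
by apply: eqAmodX; rewrite ?rpred_nat //; apply: eqAmod_geom.
Qed.

End PrimePowerRoot.

Lemma subr1_dvd_subrX1 (z : algC) m : z \in Aint -> z - 1 != 0 -> 
  (z - 1 %| z ^+ m - 1)%A.
Proof.
move=> Zz nz; apply/dvdAP => //; exists (\sum_(i < m) z ^+ i).
  by rewrite rpred_sum // => i _; rewrite rpredX.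
by rewrite -subrX1.
Qed.

Section NonVanish.
Variables (e : nat) (z : algC) (k : nat).

(** An odd square is 1 modulo 8, and z - 1 divides 2, so its cube divides 8. *)
Lemma gp_char_det_neq0_2 (c0 : nat) : (2 ^ e.+1).-primitive_root z ->
  odd c0 -> ~~ odd k -> gp_char_det z c0%:R k != 0.
Proof.
move=> z_prim c_odd k_even; apply: (gp_char_det_neq0 (isT : prime 2) z_prim); last first.
  by rewrite dvdn2 negbK oddM c_odd oddD oddX (negPf k_even).
have nz := prim_root_subr1_neq0 (isT : prime 2) z_prim.
have /(dvdAP _ nz)[w Zw E2] := subr1_dvd_p (isT : prime 2) z_prim.
apply/(dvdAP _ (expf_neq0 3 nz)).
have [m Em] : exists m : nat, c0%:R ^+ 2 - 1 = 2%:R ^+ 3 * m%:R :> algC.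
  exists 'C((c0./2).+1, 2); rewrite -[c0 in LHS]odd_double_half c_odd.
  rewrite -!natrX -natrM.
  apply/eqP; rewrite subr_eq -[1]/1%:R -natrD eqr_nat.
  have := mul_bin_diag (c0./2).+1 1; rewrite bin1 -mulnn; move: (c0./2) 'C(_,_) => a b; nia.
exists (w ^+ 3 * m%:R); first by rewrite rpredM ?rpredX ?rpred_nat.
by rewrite Em E2 exprMn mulrA.
Qed.

(** Here c0^2 - 1 = 15 = 3 (w - 1) (w^2 - 1) (w^3 - 1) (w^4 - 1) for w a
    primitive fifth root of unity, and z - 1 divides each factor. *)
Lemma gp_char_det_neq0_5 : (5 ^ e.+1).-primitive_root z ->
  ~~ (5 %| k ^ 2 + 1)%N -> gp_char_det z 4%:R k != 0.
Proof.
move=> z_prim k5; have p5 : prime 5 by [].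
apply: (gp_char_det_neq0 p5 z_prim); last by rewrite Gauss_dvdr // addnC.
have nz := prim_root_subr1_neq0 p5 z_prim.
have Zz := Aint_prim_root z_prim.
have := geom_order_p p5 z_prim.
rewrite !big_ord_recr big_ord0 /=; set w := z ^+ (5 ^ e) => w5.
have dvd_s j : exists2 g, g \in Aint & w ^+ j - 1 = (z - 1) * g.
  by apply/(dvdAP _ nz); rewrite -exprM; apply: subr1_dvd_subrX1.
have [g1 Z1 E1] := dvd_s 1%N; have [g2 Z2 E2] := dvd_s 2.
have [g3 Z3 E3] := dvd_s 3; have [g4 Z4 E4] := dvd_s 4.
apply/(dvdAP _ (expf_neq0 3 nz)).
exists (3%:R * (g1 * g2 * g3 * ((z - 1) * g4))).
  by rewrite !rpredM ?rpred_nat ?rpredB ?Aint1.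
transitivity (3%:R * ((w ^+ 1 - 1) * (w ^+ 2 - 1) * (w ^+ 3 - 1) * (w ^+ 4 - 1))); last first.
  by rewrite E1 E2 E3 E4; ring.
(* the multiplier is the cofactor of 1 + w + w^2 + w^3 + w^4 in
   5 - (w - 1) (w^2 - 1) (w^3 - 1) (w^4 - 1) *)
rewrite -[LHS]subr0.
rewrite -[X in _ - X](mulr0 (3%:R * (4%:R - 3%:R * w - w ^+ 3 + 2%:R * w ^+ 5 - w ^+ 6))) -w5.
ring.
Qed.

(** Write 3 = (w - 1) (w^2 - 1) with w a primitive cube root of unity.  When the
    order of z is at least 9, w = t^3 with t a power of z, and z - 1 divides both
    factors of w - 1 = (t - 1) (1 + t + t^2) because 1 + t + t^2 is congruent
    to 3; so the cube of z - 1 divides c0^2 - 1 = 3.  For z of order 3 only the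
    square does.  As -1 is not a square modulo 3, k is arbitrary. *)
Lemma gp_char_det_neq0_3 : (3 ^ e.+2).-primitive_root z ->
  gp_char_det z 2%:R k != 0.
Proof.
move=> z_prim; have p3 : prime 3 by [].
apply: (gp_char_det_neq0 p3 z_prim); last first.
  rewrite Gauss_dvdr // /dvdn -modnDmr -modnXm.
  by case: (k %% 3)%N (ltn_pmod k (isT : 0 < 3)%N) => [|[|[|]]].
have nz := prim_root_subr1_neq0 p3 z_prim.
have Zz := Aint_prim_root z_prim.
have := geom_order_p p3 z_prim.
rewrite expnSr exprM; set t := z ^+ (3 ^ e); rewrite !big_ord_recr big_ord0 /= => w0.
have dvd_s m : exists2 g, g \in Aint & z ^+ m - 1 = (z - 1) * g.
  by apply/(dvdAP _ nz); apply: subr1_dvd_subrX1.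
have [g Zg Eg] := dvd_s (3 ^ e)%N; have [f Zf Ef] := dvd_s (3 ^ e * (3 * 2))%N.
have /(dvdAP _ nz)[h Zh Eh] : (z - 1 %| 1 + t + t ^+ 2)%A.
  rewrite -eqAmod0; have := subr1_dvd_p p3 z_prim; rewrite -eqAmod0.
  apply: eqAmod_trans; have -> : 3%:R = 1 + 1 + 1 :> algC by ring.
  have t1 m : (t ^+ m == 1 %[mod z - 1])%A.
    by rewrite -exprM; apply: (eqAmod_rootX_1 z_prim).
  by rewrite !eqAmodD // (t1 1%N).
apply/(dvdAP _ (expf_neq0 3 nz)); exists (g * h * f); first by rewrite !rpredM.
transitivity ((t - 1) * (1 + t + t ^+ 2) * ((t ^+ 3) ^+ 2 - 1)); last first.
  by rewrite Eh /t Eg -!exprM Ef; ring.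
rewrite -[LHS]subr0 -[X in _ - X](mulr0 (2%:R - t ^+ 3)) -w0.
ring.
Qed.

(** Now z^k = 1, and 1 + z + z^2 = 0 reduces the determinant to - 3 z. *)
Lemma gp_char_det_neq0_3_base : 3.-primitive_root z -> (3 %| k)%N ->
  gp_char_det z 2%:R k != 0.
Proof.
move=> z_prim; rewrite (prim_order_dvd z_prim) => /eqP zk.
have p3 : prime 3 by [].
have z_prim1 : (3 ^ 0.+1).-primitive_root z by [].
have := geom_order_p p3 z_prim1.
rewrite !big_ord_recr big_ord0 /= !expr1 => z0.
rewrite /gp_char_det zk.
have -> : ((z - 1) ^+ 2 + 2%:R * z) * ((1 - 1) ^+ 2 + 2%:R * 1) - z * 1 = - (3%:R * z).
  rewrite -[RHS]addr0 -[X in _ = _ + X](mulr0 2%:R) -z0; ring.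
rewrite oppr_eq0 mulf_neq0 ?pnatr_eq0 //.
by rewrite (prim_root_eq0 z_prim).
Qed.
End NonVanish.

(** * Fourier analysis on the cyclic group *)

Lemma sum_unity_root (F : fieldType) (w : F) m :
  w ^+ m = 1 -> w != 1 -> \sum_(i < m) w ^+ i = 0.
Proof.
rewrite -subr_eq0 => wm nz; apply: (mulfI nz).
by rewrite mulr0 -subrX1 wm subrr.
Qed.

Section Shift.
Variables (n : nat) (n3 : (2 < n)%N) (z : algC) (zn : z ^+ n = 1).

Lemma Zp_exprD (i : 'Z_n) k : z ^+ (i + k%:R : 'Z_n)%R = z ^+ i * z ^+ k.
Proof.
rewrite Zp_addE ?(ltnW n3) // val_Zp_nat ?(ltnW n3) // modnDmr.
by rewrite expr_mod // exprD.
Qed.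

Lemma sum_shift_add (f : 'Z_n -> algC) k :
  z ^+ k * \sum_i f (i + k%:R) * z ^+ i = \sum_i f i * z ^+ i.
Proof.
rewrite [RHS](reindex_inj (addIr k%:R)) mulr_sumr; apply: eq_bigr => i _.
by rewrite Zp_exprD mulrCA [z ^+ k * _]mulrC.
Qed.

Lemma sum_shift_sub (f : 'Z_n -> algC) k :
  \sum_i f (i - k%:R) * z ^+ i = z ^+ k * \sum_i f i * z ^+ i.
Proof.
rewrite (reindex_inj (addIr k%:R)) mulr_sumr; apply: eq_bigr => i _.
by rewrite addrK Zp_exprD mulrA mulrC.
Qed.

Lemma sum_Zp_expr : z != 1 -> \sum_(i : 'Z_n) z ^+ i = 0.
Proof. by move=> z1; apply: sum_unity_root z1; rewrite Zp_cast // ltnW. Qed.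
End Shift.

(** Fourier inversion at 0 for x folded modulo N: summing the transforms over all
    N-th roots of unity keeps only the indices divisible by N, while by
    hypothesis only the trivial root contributes, with the total of x. *)
Lemma dvdn_sum_of_vanishing n N (x : 'Z_n -> nat) (z : algC) :
  (2 < n)%N -> N.-primitive_root z ->
  (forall m, (0 < m < N)%N -> \sum_i (x i)%:R * (z ^+ m) ^+ i = 0) ->
  (N %| \sum_i x i)%N.
Proof.
move=> n3 z_prim x0; have N0 := prim_order_gt0 z_prim.
pose a := (\sum_(i : 'Z_n | N %| i) x i)%N.
suff : (\sum_i x i)%N%:R = (a * N)%:R :> algC.
  by move/eqP; rewrite eqr_nat => /eqP ->; apply: dvdn_mull.
have -> : (\sum_i x i)%N%:R = \sum_(m < N) \sum_i (x i)%:R * (z ^+ m) ^+ i.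
  rewrite -(prednK N0) [RHS]big_ord_recl [X in _ + X]big1 ?addr0 => [|m _].
    by rewrite natr_sum; apply: eq_bigr => i _; rewrite expr0 expr1n mulr1.
  by apply: x0; rewrite /= /bump add1n -ltn_predRL ltn_ord.
rewrite exchange_big natrM /a natr_sum mulr_suml [RHS]big_mkcond.
apply: eq_bigr => i _; rewrite -mulr_sumr.
under eq_bigr do rewrite exprAC.
case: ifP => [|/negP] Ni.
  have -> : z ^+ i = 1 by apply/eqP; rewrite -(prim_order_dvd z_prim).
  under eq_bigr do rewrite expr1n.
  by rewrite sumr_const card_ord.
rewrite sum_unity_root ?mulr0 //; first by rewrite exprAC (prim_expr_order z_prim) ?expr1n.
by apply/negP; rewrite -(prim_order_dvd z_prim).
Qed.

(** The transform of a recurrence along steps of length s.  It is multiplied by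
    z^s to avoid negative powers, and the constant u disappears because the
    transform of a constant vanishes at z <> 1. *)
Lemma cycle_transform n (s : nat) (z : algC) (f g : 'Z_n -> algC) (u w : algC) :
    (2 < n)%N -> z ^+ n = 1 -> z != 1 ->
    (forall i, f (i + s%:R) + f (i - s%:R) + g i = u + (2%:R - w) * f i) ->
  ((z ^+ s - 1) ^+ 2 + w * z ^+ s) * (\sum_i f i * z ^+ i)
  = - (z ^+ s * \sum_i g i * z ^+ i).
Proof.
move=> n3 zn z1 E.
have : z ^+ s * (\sum_i (f (i + s%:R) + f (i - s%:R) + g i) * z ^+ i) =
       z ^+ s * (\sum_i (u + (2%:R - w) * f i) * z ^+ i).
  by congr (_ * _); apply: eq_bigr => i _; rewrite E.
have -> : \sum_i (u + (2%:R - w) * f i) * z ^+ i = (2%:R - w) * \sum_i f i * z ^+ i.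
  under eq_bigr do rewrite mulrDl -mulrA.
  by rewrite big_split /= -!mulr_sumr (sum_Zp_expr n3 zn z1) mulr0 add0r.
under eq_bigr do rewrite !mulrDl.
rewrite !big_split /= !mulrDr sum_shift_add // sum_shift_sub //.
move: (\sum_i f i * _) (\sum_i g i * _) => F G EF.
apply/eqP; rewrite -addr_eq0; apply/eqP.
transitivity (F + z ^+ s * (z ^+ s * F) + z ^+ s * G - z ^+ s * ((2%:R - w) * F)); first by ring.
by rewrite EF subrr.
Qed.

(** * Conditions forced by an intersection array *)

Section Necessity.
Variables (n k : nat) (n3 : (2 < n)%N) (k0 : (0 < k)%N) (kn : (2 * k < n)%N).
Local Notation adj := (@gp_adj n k).
Variables (C : {set gp_vertex n}) (b c : nat).
Hypothesis Cbc : has_intersection_array adj C b c.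

Local Notation x i := ((inl i : gp_vertex n) \in C).
Local Notation y i := ((inr i : gp_vertex n) \in C).

(** A single equation covers both kinds of vertices: the count is c off C, and
    3 - b = c + 3 - (b + c) on C. *)
Lemma array_balance v :
  (count (mem C) (gp_nbrs k v) + (b + c) * (v \in C) = c + 3 * (v \in C))%N.
Proof.
have [Cb Cc] := Cbc; case: (boolP (v \in C)) => vC /=.
  have := Cb v vC; rewrite gp_count // => Eb.
  have := count_predC (mem C) (gp_nbrs k v).
  rewrite (@eq_count _ (predC (mem C)) (mem (~: C))) ?Eb => [|w]; last by rewrite /= !inE.
  rewrite (_ : size _ = 3%N) => [E|]; last by case: (v).
  by rewrite !muln1 addnA E addnC.
by rewrite -gp_count // Cc // !muln0 !addn0.
Qed.

Hypothesis bc3 : (3 <= b + c)%N.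
Let c0 := (b + c).-1.

Lemma array_balanceC v :
  (count (mem C) (gp_nbrs k v))%:R
  = c%:R + (2%:R - c0%:R) * (v \in C)%:R :> algC.
Proof.
have := congr1 (fun m : nat => m%:R : algC) (array_balance v).
rewrite /c0 -{1}(prednK (ltnW (ltnW bc3))) natrD natrM natrD natrM -addn1 natrD.
by move/(canRL (addrK _)) => ->; ring.
Qed.

Lemma array_outer (i : 'Z_n) :
  (x (i + 1%:R))%:R + (x (i - 1%:R))%:R + (y i)%:R = c%:R + (2%:R - c0%:R) * (x i)%:R :> algC.
Proof. by rewrite -array_balanceC /= addn0 !natrD addrA. Qed.

Lemma array_inner (i : 'Z_n) :
  (y (i + k%:R))%:R + (y (i - k%:R))%:R + (x i)%:R = c%:R + (2%:R - c0%:R) * (y i)%:R :> algC.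
Proof. by rewrite -array_balanceC /= addn0 !natrD addrA. Qed.

(** Eliminating the transform of y between the two rims leaves the determinant
    times the transform of x. *)
Lemma array_transform (z : algC) : z ^+ n = 1 -> z != 1 ->
  gp_char_det z c0%:R k != 0 -> \sum_i (x i)%:R * z ^+ i = 0.
Proof.
move=> zn z1 nzP; apply: (mulfI nzP); rewrite mulr0 mulrBl -mulrA [X in X - _]mulrCA.
have Eo := cycle_transform n3 zn z1 array_outer; rewrite expr1 in Eo.
rewrite Eo mulrN mulrCA (cycle_transform n3 zn z1 array_inner).
ring.
Qed.

(** Let A and B be the totals of x and y.  Each rim gives one linear equation, and
    their difference is (b + c - 2) (A - B) = 0; so A = B when b + c > 2. *)
Lemma array_sum_outer : ((b + c) * \sum_i x i = c * n)%N.
Proof.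
pose A := (\sum_i x i)%N; pose B := (\sum_i y i)%N.
have shift (f : 'Z_n -> nat) j : (\sum_i f (i + j)%R = \sum_i f i)%N.
  by rewrite [RHS](reindex_inj (addIr j)).
have total : (\sum_(i : 'Z_n) c = c * n)%N.
  by rewrite sum_nat_const card_ord Zp_cast ?(ltnW n3) // mulnC.
have sum_eq (f g : 'Z_n -> bool) j :
    (forall i, f (i + j)%R + f (i - j)%R + g i + (b + c) * f i = c + 3 * f i)%N ->
    (\sum_i f i + \sum_i f i + \sum_i g i + (b + c) * \sum_i f i
     = c * n + 3 * \sum_i f i)%N.
  move=> E; rewrite -total -{1}(shift f j) -{1}(shift f (- j)).
  rewrite !big_distrr -!big_split /=.
  by apply: eq_bigr => i _; apply: E.
have EA : (A + A + B + (b + c) * A = c * n + 3 * A)%N.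
  apply: (sum_eq _ _ 1) => i.
  by rewrite -(array_balance (inl i)) /= addn0 addnA.
have EB : (B + B + A + (b + c) * B = c * n + 3 * B)%N.
  apply: (sum_eq _ _ k%:R) => i.
  by rewrite -(array_balance (inr i)) /= addn0 addnA.
rewrite -/A -/B; move: A B EA EB => A B EA EB.
suff AB : A = B by subst B; lia.
have : ((b + c - 2) * A = (b + c - 2) * B)%N by rewrite !mulnBl; lia.
by move/eqP; rewrite eqn_pmul2l ?subn_gt0 // => /eqP.
Qed.

(** The indicator x then has total a p^(v_p(n)), and comparing with
    (b + c) A = c n leaves an identity in which m, the part of n prime to p,
    replaces n. *)
Lemma array_pfactor p : prime p ->
  (forall z e, (p ^ e.+1).-primitive_root z ->
    gp_char_det z c0%:R k != 0) ->
  exists2 m, ~~ (p %| m)%N & exists a, ((b + c) * a = c * m)%N.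
Proof.
move=> p_pr nz; have n_gt0 : (0 < n)%N by apply: leq_trans n3.
have [z z_prim] := C_prim_root_exists (pfactor_gt0 p n : 0 < p ^ logn p n)%N.
have [m co_pm En] := pfactor_coprime p_pr n_gt0.
exists m; first by rewrite -prime_coprime.
have /dvdnP[a Ea] : (p ^ logn p n %| \sum_i x i)%N.
  apply: (dvdn_sum_of_vanishing n3 z_prim) => j /andP[j0 jN].
  have zj_n : (z ^+ j) ^+ n = 1.
    by rewrite En exprAC mulnC exprM (prim_expr_order z_prim) !expr1n.
  have zj_1 : z ^+ j != 1.
    by rewrite -(prim_order_dvd z_prim) gtnNdvd.
  apply: array_transform => //.
  have zj_prim := exp_prim_root z_prim j.
  have /(dvdn_pfactor _ _ p_pr)[[|e] _ Ee] :
      (p ^ logn p n %/ gcdn j (p ^ logn p n) %| p ^ logn p n)%N.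
    exact: dvdn_div (dvdn_gcdr _ _).
    by rewrite Ee in zj_prim; rewrite -[z ^+ j]expr1 (prim_expr_order zj_prim) eqxx in zj_1.
  by rewrite Ee in zj_prim; apply: nz zj_prim.
exists a; have := array_sum_outer; rewrite Ea [X in (_ = _ * X)%N]En !mulnA.
by move/eqP; rewrite eqn_pmul2r ?pfactor_gt0 // => /eqP.
Qed.

End Necessity.

Section Conditions.
Variables (n k : nat) (n3 : (2 < n)%N) (k0 : (0 < k)%N) (kn : (2 * k < n)%N).
Local Notation adj := (@gp_adj n k).

(** If the condition on k fails, [array_pfactor] gives (b + c) a = c m with m
    prime to p, although p divides b + c to a higher power than c. *)
Lemma array_admissible (C : {set gp_vertex n}) b c :
  has_intersection_array adj C b c -> (0 < b <= 3)%N -> (0 < c <= 3)%N ->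
  admissible n k b c.
Proof.
move=> Cbc b13 c13.
have [[-> ->]|bc3] : (b = 1 /\ c = 1 \/ 3 <= b + c)%N by lia.
  by left.
have sums := array_sum_outer n3 k0 kn Cbc bc3.
have pf := array_pfactor n3 k0 kn Cbc bc3.
move: (\sum_i _)%N sums => A sums.
have k_odd : (b + c = 4 \/ b + c = 6 /\ c = 3)%N -> odd k.
  move=> bc; apply/negPn/negP => k_even.
  have [] := pf 2 isT.
    move=> z e z_prim; apply: (gp_char_det_neq0_2 z_prim) => //.
    by case: bc => [->|[->]].
  move=> m; rewrite dvdn2 negbK => m_odd [a]; have := odd_double_half m; rewrite m_odd.
  move: (m./2) bc b13 c13 {pf sums Cbc} => h bc b13 c13 <-.
  case: bc => [->|[-> ->]]; last by lia.
  by have [->|[->|->]] : (c = 1 \/ c = 2 \/ c = 3)%N; lia.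
have k_3 : (b + c = 3)%N -> ~~ (3 %| k)%N.
  move=> bc; apply/negP => k3.
  have [] := pf 3 isT; rewrite bc.
    move=> z [|e] z_prim; last exact: gp_char_det_neq0_3 z_prim.
    exact: gp_char_det_neq0_3_base z_prim k3.
  move=> m m3 [a Ea].
  have [Ec|Ec] : (c = 1 \/ c = 2)%N by lia.
    by move: Ea m3; rewrite Ec; lia.
  by move: Ea m3; rewrite Ec; lia.
have k_5 : (b + c = 5)%N -> (k = 2 %[mod 5] \/ k + 2 = 0 %[mod 5])%N.
  move=> bc; suff : (5 %| k ^ 2 + 1)%N.
    rewrite /dvdn -modnDml -modnXm -(modnDml k).
    by case: (k %% 5)%N (ltn_pmod k (isT : 0 < 5)%N) => [|[|[|[|[|]]]]] // _ _; [left|right].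
  apply/negPn/negP => k5; have [] := pf 5 isT; rewrite bc.
    by move=> z e z_prim; apply: (gp_char_det_neq0_5 z_prim).
  move=> m m5 [a Ea].
  have [Ec|Ec] : (c = 2 \/ c = 3)%N by lia.
    by move: Ea m5; rewrite Ec; lia.
  by move: Ea m5; rewrite Ec; lia.
rewrite /admissible.
case: b c b13 c13 sums k_odd k_3 k_5 {Cbc pf bc3}
  => [|[|[|[|b]]]] [|[|[|[|c]]]] //= _ _ sums k_odd k_3 k_5.
- by left.
- right; left; split; [by left | split; [lia | exact: k_3]].
- do 3! right; left; split; [by right | split; [lia | by apply: k_odd; left]].
- right; left; split; [by right | split; [lia | exact: k_3]].
- right; right; left; split => //; split; [lia | by apply: k_odd; left].
- do 4! right; left; split; [by right | split; [lia | exact: k_5]].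
- do 3! right; left; split; [by left | split; [lia | by apply: k_odd; left]].
- do 4! right; left; split; [by left | split; [lia | exact: k_5]].
- do 5! right; split => //; split; [lia | by apply: k_odd; right].
Qed.
End Conditions.

Local Close Scope ring_scope.

Theorem corollary1 (n k : nat) (hn : 3 <= n) (hk1 : 1 <= k) (hk2 : 2 * k < n) :
  (forall C : {set gp_vertex n},
     C != set0 -> C \proper [set: gp_vertex n] ->
     (completely_regular (@gp_adj n k) C /\ covering_radius (@gp_adj n k) C = 1)
     <->
     exists S : 'M[nat]_2,
       (equitable (@gp_adj n k) (two_cells C (~: C)) S \/
        equitable (@gp_adj n k) (two_cells (~: C) C) S) /\
       (S = mx2 2 1 1 2 \/
        (S = mx2 2 1 2 1 /\ 3 %| n /\ ~~ (3 %| k)) \/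
        (S = mx2 1 2 2 1 /\ 2 %| n /\ odd k) \/
        (S = mx2 0 3 1 2 /\ 4 %| n /\ odd k) \/
        (S = mx2 0 3 2 1 /\ 5 %| n /\
           (k = 2 %[mod 5] \/ k + 2 = 0 %[mod 5])) \/
        (S = mx2 0 3 3 0 /\ 2 %| n /\ odd k)))
  /\
  (forall b c : nat,
     (exists C : {set gp_vertex n},
        [/\ C != set0, C \proper [set: gp_vertex n],
            completely_regular (@gp_adj n k) C,
            covering_radius (@gp_adj n k) C = 1
          & has_intersection_array (@gp_adj n k) C b c])
     <->
     ((b, c) = (1, 1) \/
      (((b, c) = (1, 2) \/ (b, c) = (2, 1)) /\ 3 %| n /\ ~~ (3 %| k)) \/
      ((b, c) = (2, 2) /\ 2 %| n /\ odd k) \/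
      (((b, c) = (3, 1) \/ (b, c) = (1, 3)) /\ 4 %| n /\ odd k) \/
      (((b, c) = (3, 2) \/ (b, c) = (2, 3)) /\ 5 %| n /\
         (k = 2 %[mod 5] \/ k + 2 = 0 %[mod 5])) \/
      ((b, c) = (3, 3) /\ 2 %| n /\ odd k))).
Proof.
have cubic := gp_cubic hn hk1 hk2.
have crP C := completely_regular_radius1 cubic (@gp_adj_sym n k) (C := C).
have necessary C b c : C != set0 -> C \proper [set: gp_vertex n] -> 0 < b -> 0 < c ->
    has_intersection_array (@gp_adj n k) C b c -> admissible n k b c.
  move=> /set0Pn[v vC] /properP[_ [w _ wC]] b0 c0 arr.
  apply: (array_admissible hn hk1 hk2 arr).
    by have := card_nbrs_split cubic C v; have [-> //] := arr; lia.
  by have := card_nbrs_split cubic C w; have [_ -> //] := arr; lia.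
split=> [C C0 CT | b c]; last first.
  split=> [[C [C0 CT reg1 rad1 arr]] | adm].
    have [b' [c' [b0 c0 arr']]] := (crP C C0 CT).1 (conj reg1 rad1).
    have [-> ->] := intersection_array_inj C0 CT arr arr'.
    exact: necessary arr'.
  have [C arr] := admissible_array hn hk1 hk2 adm.
  have [b0 c0] := admissible_gt0 adm.
  have [C0 CT] := intersection_array_proper (inl 0%R) arr b0 c0.
  have [reg1 rad1] : completely_regular (@gp_adj n k) C /\ covering_radius (@gp_adj n k) C = 1.
    by apply/(crP C C0 CT); exists b, c.
  by exists C.
rewrite (crP C C0 CT); split=> [[b [c [b0 c0 arr]]] | [S [eqS cond]]].
  have adm := necessary C b c C0 CT b0 c0 arr.
  have eqC := array_two_cells_equitable cubic C0 CT arr.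
  have eqC' : equitable (@gp_adj n k) (two_cells (~: C) C) (mx2 (3 - c) c b (3 - b)).
    have arr' := intersection_array_compl arr.
    have [C0' CT'] := intersection_array_proper (inl 0%R) arr' c0 b0.
    by have := array_two_cells_equitable cubic C0' CT' arr'; rewrite setCK.
  case: adm => [[Eb Ec] | [[[[Eb Ec]|[Eb Ec]] h] | [[[Eb Ec] h] |
    [[[[Eb Ec]|[Eb Ec]] h] | [[[[Eb Ec]|[Eb Ec]] h] | [[Eb Ec] h]]]]]]; subst b c.
  - by exists (mx2 2 1 1 2); split; [left | left].
  - by exists (mx2 2 1 2 1); split; [left | right; left].
  - by exists (mx2 2 1 2 1); split; [right | right; left].
  - by exists (mx2 1 2 2 1); split; [left | do 2! right; left].
  - by exists (mx2 0 3 1 2); split; [left | do 3! right; left].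
  - by exists (mx2 0 3 1 2); split; [right | do 3! right; left].
  - by exists (mx2 0 3 2 1); split; [left | do 4! right; left].
  - by exists (mx2 0 3 2 1); split; [right | do 4! right; left].
  - by exists (mx2 0 3 3 0); split; [left | do 5! right].
have [b0 c0] : 0 < S ord0 ord_max /\ 0 < S ord_max ord0.
  by case: cond => [->|[[->]|[[->]|[[->]|[[->]|[->]]]]]]; rewrite !mxE.
case: eqS => [/two_cells_array arr | ].
  by exists (S ord0 ord_max), (S ord_max ord0).
rewrite -{2}[C]setCK => /two_cells_array/intersection_array_compl; rewrite setCK => arr.
by exists (S ord_max ord0), (S ord0 ord_max).
Qed.
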